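(* The $n$-dimensional Veselova system admits steady rotation solutions (solutions $(g(t),\Omega(t))$ whose angular velocity $\Omega$ is constant and nonzero). All of them are steady rotations in principal planes, i.e. $\Omega$ is a nonzero scalar multiple of $a\wedge b$ where $a,b$ span a principal plane $\Pi$. They are characterised by the condition $[\mathbb{I}(\Omega),\Omega]=0$: a solution with $\Omega\neq 0$ is a steady rotation if and only if $[\mathbb{I}(\Omega(t)),\Omega(t)]=0$ for all $t$. A steady rotation in the principal plane $\Pi$ is periodic with period $2\pi/\|\Omega\|$, has energy $H=\tfrac12\,\mathrm{in}(\Pi)\,\|\Omega\|^2$, and has momentum $M=\mathbb{I}(\Omega)$ satisfying $\|M\|^2=(\mathrm{in}(\Pi))^2\|\Omega\|^2$.
   Context: Let $n\ge 2$. $\mathfrak{so}(n)$ is the space of real skew-symmetric $n\times n$ matrices with pairing $\langle\Lambda,\Omega\rangle=\tfrac12\mathrm{tr}(\Lambda^T\Omega)$ and induced norm $\|\cdot\|$; $[\cdot,\cdot]$ is the matrix commutator; for $a,b\in\mathbb{R}^n$, $a\wedge b=ab^T-ba^T$. The mass tensor is $\mathbb{J}=\mathrm{diag}[J_1,\dots,J_n]$ with all $J_i>0$ (body frame = a principal basis $f_1,\dots,f_n$, identified with the standard basis of $\mathbb{R}^n$), and the inertia tensor is $\mathbb{I}:\mathfrak{so}(n)\to\mathfrak{so}(n)$, $\mathbb{I}(\Omega)=\mathbb{J}\Omega+\Omega\mathbb{J}$. A principal plane is a 2-dimensional subspace $\Pi\subset\mathbb{R}^n$ invariant under $\mathbb{J}$.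 Its moment of inertia is $\mathrm{in}(\Pi)=\lambda+\mu$, where $\lambda,\mu$ are the eigenvalues of $\mathbb{J}|_\Pi$; then $\mathbb{I}(a\wedge b)=\mathrm{in}(\Pi)\,a\wedge b$ whenever $\Pi=\mathrm{span}\{a,b\}$. The $n$-dimensional Veselova system: let $e_1,\dots,e_n$ be the standard orthonormal basis of space, $e_1$ being the distinguished axis. For $g\in\mathrm{O}(n)$ put $q=g^{-1}e_1$ and $E_r=g^{-1}e_r$. The phase space is $D=\{(g,\Omega)\in\mathrm{O}(n)\times\mathfrak{so}(n): \Omega=q\wedge v\text{ for some }v\in\mathbb{R}^n\}$ (equivalently $\langle E_r\wedge E_s,\Omega\rangle=0$ for $2\le r<s\le n$). A solution is a curve $(g(t),\Omega(t))\in D$ with $\dot g=g\Omega$ and $$\frac{d}{dt}\mathbb{I}(\Omega)=[\mathbb{I}(\Omega),\Omega]+\sum_{2\le r<s\le n}\lambda_{rs}\,E_r\wedge E_s,$$ where the multipliers $\lambda_{rs}$ are the unique solution of $\sum_{r<s}\langle\mathbb{I}^{-1}(E_\rho\wedge E_\sigma),E_r\wedge E_s\rangle\lambda_{rs}=-\langle\mathbb{I}^{-1}(E_\rho\wedge E_\sigma),[\mathbb{I}(\Omega),\Omega]\rangle$, $2\le\rho<\sigma\le n$. The energy is $H=\tfrac12\langle\mathbb{I}(\Omega),\Omega\rangle$. *)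

(* Defs.v *)
From HB Require Import structures.
From mathcomp Require Import all_boot all_order all_algebra.
From mathcomp Require Import all_classical all_reals all_analysis.

Set Implicit Arguments.
Unset Strict Implicit.
Unset Printing Implicit Defensive.

Import Order.TTheory GRing.Theory Num.Theory.
Import numFieldNormedType.Exports.

Local Open Scope classical_set_scope.
Local Open Scope ring_scope.

Section SkewMatrices.
Context {R : realType} {n : nat}.
Implicit Types (A B : 'M[R]_n) (a b : 'cV[R]_n).

Definition skew A : Prop := A^T = - A.

Definition orthogonal_mx A : Prop := A^T *m A = 1%:M.

Definition so_dot A B : R := 2^-1 * \tr (A^T *m B).

Definition so_norm A : R := Num.sqrt (so_dot A A).

Definition lie A B : 'M[R]_n := A *m B - B *m A.

Definition wedge a b : 'M[R]_n := a *m b^T - b *m a^T.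

End SkewMatrices.

Section RigidBody.
Context {R : realType} {n : nat}.
Variable J : 'rV[R]_n.
Implicit Types (A : 'M[R]_n) (P : 'M[R]_n).

Definition mass_tensor : 'M[R]_n := diag_mx J.

Definition inertia A : 'M[R]_n := mass_tensor *m A + A *m mass_tensor.

(* The (i, j) entry of [inertia A] is (J_i + J_j) A_ij; see [inertiaK] and
   [inertia_invK] below. *)
Definition inertia_inv A : 'M[R]_n := \matrix_(i, j) (A i j / (J 0 i + J 0 j)).

Definition energy A : R := 2^-1 * so_dot (inertia A) A.

(* Subspaces are row spaces of matrices: a column vector [a] belongs to the
   subspace [P] when (a^T <= P)%MS.  As the mass tensor is symmetric, acting on
   rows from the right is the same as acting on columns from the left. *)
Definition principal_plane P : Prop :=
  \rank P = 2%N /\ stablemx P mass_tensor.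

(* [l] and [m] are the eigenvalues, with multiplicity, of the restriction of
   the mass tensor to the plane [P]. *)
Definition plane_eigenvalues P (l m : R) : Prop :=
  char_poly (restrictmx P mass_tensor) = ('X - l%:P) * ('X - m%:P).

(* The set below has at most one element; see [moment_of_inertiaE]. *)
Definition moment_of_inertia P : R :=
  xget 0 [set c | exists l m, plane_eigenvalues P l m /\ c = l + m].

Definition rotation_in_principal_plane P A : Prop :=
  principal_plane P /\
  exists (a b : 'cV[R]_n) (c : R),
    [/\ c != 0, (P == a^T + b^T)%MS & A = c *: wedge a b].

Lemma inertiaE A i j : inertia A i j = (J 0 i + J 0 j) * A i j.
Proof. by rewrite mxE mul_diag_mx mul_mx_diag !mxE mulrDl (mulrC (A i j)). Qed.

Lemma inertiaK : (forall i, 0 < J 0 i) -> cancel inertia inertia_inv.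
Proof.
move=> J_gt0 A; apply/matrixP => i j; rewrite mxE inertiaE mulrC mulKf //.
by rewrite lt0r_neq0 // addr_gt0.
Qed.

Lemma inertia_invK : (forall i, 0 < J 0 i) -> cancel inertia_inv inertia.
Proof.
move=> J_gt0 A; apply/matrixP => i j; rewrite inertiaE mxE mulrC divfK //.
by rewrite lt0r_neq0 // addr_gt0.
Qed.

Lemma moment_of_inertiaE P l m :
  plane_eigenvalues P l m -> moment_of_inertia P = l + m.
Proof.
move=> lmP; apply: xget_unique; first by exists l, m.
move=> _ [l' [m' [lmP' ->]]].
have coef1 (x y : R) : (('X - x%:P) * ('X - y%:P))`_1 = - (x + y).
  rewrite mulrBl !mulrBr !coefB !coefXM !coefCM !coefC !coefX /=.
  by rewrite mulr1 mulr0 subr0 sub0r opprD addrC.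
by apply: oppr_inj; rewrite -!coef1 -lmP -lmP'.
Qed.

End RigidBody.

Section Veselova.
Context {R : realType} {n : nat}.
Variable J : 'rV[R]_n.
Implicit Types (g Om : R -> 'M[R]_n).

(* The vectors e_1, ..., e_n have indices 0, ..., n - 1 here, so that e_1 is
   the vector with index 0 and the indices r >= 2 become the r with 0 < r. *)
Definition space_axis1 : 'cV[R]_n := \col_i (val i == 0%N)%:R.

Definition space_axis (r : 'I_n) : 'cV[R]_n := delta_mx r 0.

Definition body_axis1 (g0 : 'M[R]_n) : 'cV[R]_n := invmx g0 *m space_axis1.

Definition body_axis (g0 : 'M[R]_n) (r : 'I_n) : 'cV[R]_n :=
  invmx g0 *m space_axis r.

Definition phase_space (g0 Om0 : 'M[R]_n) : Prop :=
  [/\ orthogonal_mx g0, skew Om0 &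
      exists v : 'cV[R]_n, Om0 = wedge (body_axis1 g0) v].

(* Only the entries [lam r s] with 0 < r < s are meaningful. *)
Definition multipliers (g0 Om0 lam : 'M[R]_n) : Prop :=
  forall p q : 'I_n, (0 < p < q)%N ->
    let Epq := inertia_inv J (wedge (body_axis g0 p) (body_axis g0 q)) in
    \sum_(r < n) \sum_(s < n | (0 < r < s)%N)
      so_dot Epq (wedge (body_axis g0 r) (body_axis g0 s)) * lam r s =
    - so_dot Epq (lie (inertia J Om0) Om0).

Definition reaction (g0 lam : 'M[R]_n) : 'M[R]_n :=
  \sum_(r < n) \sum_(s < n | (0 < r < s)%N)
    lam r s *: wedge (body_axis g0 r) (body_axis g0 s).

Definition veselova_solution g Om : Prop :=
  forall t : R,
    [/\ phase_space (g t) (Om t),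
        is_derive t 1 g (g t *m Om t) &
        exists2 lam : 'M[R]_n, multipliers (g t) (Om t) lam &
          is_derive t 1 (fun s => inertia J (Om s))
            (lie (inertia J (Om t)) (Om t) + reaction (g t) lam)].

Definition steady_rotation g Om : Prop :=
  veselova_solution g Om /\
  exists2 Om0 : 'M[R]_n, Om0 != 0 & forall t, Om t = Om0.

End Veselova.

Definition least_period {R : realType} {V : zmodType} (f : R -> V) (p : R) :
    Prop :=
  [/\ 0 < p, periodic f p & forall s, 0 < s < p -> ~ periodic f s].

(* Main.v *)
Require Import Defs.
From mathcomp Require Import all_boot all_order all_algebra.
From mathcomp Require Import all_classical all_reals all_analysis.
From mathcomp Require Import ring lra.

Import Order.TTheory GRing.Theory Num.Theory.
Import numFieldNormedType.Exports.

Local Open Scope ring_scope.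

Set Implicit Arguments.
Unset Strict Implicit.
Unset Printing Implicit Defensive.

(** Write [A] for the angular velocity, [M] for the mass tensor and
    [C = [I(A), A]].  Three facts carry the proof.

    First, [C = M A^2 - A^2 M] ([lie_inertia]), while a point [A = q /\ v] of
    the constraint satisfies [A^3 = - |A|^2 A] ([wedge_cube]).  So [C = 0] says
    that [M] commutes with [- A^2 / |A|^2], the orthogonal projection onto the
    plane of [A]; that is, this plane is principal ([lie0_principal]).

    Second, the reaction kills the constrained axis [q] ([reaction_axis1]).  If
    [A] is constant, the momentum equation reads [C + reaction = 0], so
    [C q = 0] along the motion.  As [C] is constant and [q] turns inside the
    plane of [A] with velocity [- A q], differentiating gives [C A q = 0].  Thus
    [C] vanishes on the whole plane of [A], i.e. [C A = 0], and the shape of [C]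
    then forces [C = 0] ([steady_lie]).  Conversely, if [C = 0] along a
    solution, the multipliers solve a homogeneous system with a positive
    definite Gram matrix, so the reaction vanishes and [I(A)], hence [A], is
    constant ([lie0_steady]).

    Third, for constant [A] with [w = |A|], the cubic identity sums the
    exponential series of [t A] to the Rodrigues formula
    [1 + sin(w t)/w A + (1 - cos(w t))/w^2 A^2] ([rotation]).  It gives every
    solution of [g' = g A] ([rotation_unique]), so that the period is
    [2 pi / w] ([steady_period]); it also gives an explicit steady rotation in
    the plane of two coordinate axes ([steady_exists]).

    The energy and the momentum only need [I(A) = in(P) A]
    ([inertia_principal]): on a plane stable under [M], the map
    [A |-> M A + A M] acts on the line of bivectors as multiplication by the
    trace of the restriction of [M], which is the sum of its eigenvalues. *)

(** * Simple bivectors and the pairing *)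

Section Wedge.
Context {R : realType} {n : nat}.
Implicit Types (a b c : 'cV[R]_n) (A B : 'M[R]_n).

Definition dot a b : R := (a^T *m b) 0 0.

Lemma dotC a b : dot a b = dot b a.
Proof. by rewrite /dot -[a^T *m b]trmxK trmx_mul trmxK mxE. Qed.

Lemma tr_mulmx_col a b : a^T *m b = (dot a b)%:M.
Proof. exact: mx11_scalar. Qed.

Lemma mxtrace_col_row a b : \tr (a *m b^T) = dot b a.
Proof. by rewrite mxtrace_mulC tr_mulmx_col mxtrace_scalar mulr1n. Qed.

Lemma tr_wedge a b : (wedge a b)^T = - wedge a b.
Proof. by rewrite raddfB /= !trmx_mul !trmxK opprB. Qed.

Lemma wedgeZl k a b : wedge (k *: a) b = k *: wedge a b.
Proof. by rewrite /wedge linearZ /= -scalemxAl -scalemxAr scalerBr. Qed.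

Lemma wedgeZr k a b : wedge a (k *: b) = k *: wedge a b.
Proof. by rewrite /wedge linearZ /= -scalemxAl -scalemxAr scalerBr. Qed.

Lemma wedge_mul a b c : wedge a b *m c = dot b c *: a - dot a c *: b.
Proof. by rewrite mulmxBl -!mulmxA !tr_mulmx_col !mul_mx_scalar. Qed.

(** The square of [a /\ b] preserves the plane of [a] and [b], where it is
    scalar: it is minus the Gram determinant, i.e. minus the squared norm of
    [a /\ b]. *)
Lemma wedge_sq_l a b :
  wedge a b *m (wedge a b *m a) = (dot a b ^+ 2 - dot a a * dot b b) *: a.
Proof.
rewrite [X in _ *m X]wedge_mul mulmxBr -!scalemxAr !wedge_mul !scalerBr.
rewrite !scalerA !(dotC b a).
by rewrite opprB (mulrC (dot a a) (dot a b)) subrKA -scalerBl -expr2.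
Qed.

Lemma wedge_sq_r a b :
  wedge a b *m (wedge a b *m b) = (dot a b ^+ 2 - dot a a * dot b b) *: b.
Proof.
rewrite [X in _ *m X]wedge_mul mulmxBr -!scalemxAr !wedge_mul !scalerBr.
rewrite !scalerA !(dotC b a).
rewrite (mulrC (dot b b) (dot a b)) opprB addrC subrKA.
by rewrite -scalerBl -expr2 (mulrC (dot b b)).
Qed.

Lemma so_dot_wedge a b :
  so_dot (wedge a b) (wedge a b) = dot a a * dot b b - dot a b ^+ 2.
Proof.
rewrite /so_dot (tr_wedge a b) mulNmx {2}/wedge mulmxBr !mulmxA !wedge_mul.
rewrite !mulmxBl -!scalemxAl raddfN !raddfB /= !mxtraceZ !mxtrace_col_row.
by rewrite (dotC b a); field.
Qed.

(** So a simple bivector vanishes on the orthogonal complement of its plane and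
    turns vectors of the plane by a right angle, up to scale.  This identity
    makes the series of [exp (t W)] close up after its second power, and makes
    [W^2] a multiple of the projection onto the plane. *)
Lemma wedge_cube a b (W := wedge a b) : W *m W *m W = - so_dot W W *: W.
Proof.
have sq c d : W *m (W *m (c *m d^T)) = W *m (W *m c) *m d^T.
  by rewrite !mulmxA.
rewrite so_dot_wedge opprB -mulmxA {3}/W [X in _ *m (_ *m X)]/wedge.
by rewrite !mulmxBr !sq wedge_sq_l wedge_sq_r -!scalemxAl -scalerBr.
Qed.

Lemma so_dotE A B : so_dot A B = 2^-1 * \sum_i \sum_j A i j * B i j.
Proof.
rewrite /so_dot /mxtrace exchange_big; congr (_ * _); apply: eq_bigr => j _.
by rewrite mxE; apply: eq_bigr => i _; rewrite mxE.
Qed.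

Lemma so_dotZr A B (k : R) : so_dot A (k *: B) = k * so_dot A B.
Proof. by rewrite /so_dot -scalemxAr mxtraceZ mulrCA. Qed.

Lemma so_dotC A B : so_dot A B = so_dot B A.
Proof. by rewrite /so_dot -[\tr (A^T *m B)]mxtrace_tr trmx_mul trmxK. Qed.

Lemma so_dot0r A : so_dot A 0 = 0.
Proof. by rewrite -(scale0r A) so_dotZr mul0r. Qed.

Lemma so_dot_sumr A (I : Type) (r : seq I) (p : pred I) (F : I -> 'M[R]_n) :
  so_dot A (\sum_(i <- r | p i) F i) = \sum_(i <- r | p i) so_dot A (F i).
Proof. by rewrite /so_dot mulmx_sumr raddf_sum mulr_sumr. Qed.

Lemma so_dot_ge0 A : 0 <= so_dot A A.
Proof.
by rewrite so_dotE mulr_ge0 // !sumr_ge0 // => i _; rewrite sumr_ge0 // => j _;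
  rewrite -expr2 sqr_ge0.
Qed.

Lemma so_norm_sq A : so_norm A ^+ 2 = so_dot A A.
Proof. by rewrite sqr_sqrtr // so_dot_ge0. Qed.

(** Stated with positive weights so as to cover both the pairing itself and the
    form given by the inverse inertia tensor, whose weights are
    [1 / (J_i + J_j)]. *)
Lemma weighted_so_dot_eq0 (w : 'M[R]_n) A :
  (forall i j, 0 < w i j) ->
  so_dot (\matrix_(i, j) (w i j * A i j)) A = 0 -> A = 0.
Proof.
move=> w_gt0; have pos i j : 0 <= w i j * A i j * A i j.
  by rewrite -mulrA -expr2 mulr_ge0 ?sqr_ge0 // ltW.
rewrite so_dotE => /eqP; rewrite mulf_eq0 invr_eq0 pnatr_eq0 /=.
under eq_bigr do under eq_bigr do rewrite mxE.
rewrite psumr_eq0 => [/allP sum0|i _]; last by rewrite sumr_ge0.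
apply/matrixP => i j; have := sum0 i (mem_index_enum _).
rewrite /= psumr_eq0 // => /allP /(_ j (mem_index_enum _)) /=.
by rewrite !mulf_eq0 (gt_eqF (w_gt0 _ _)) orbb => /eqP->; rewrite mxE.
Qed.

Lemma so_norm_gt0 A : A != 0 -> 0 < so_norm A.
Proof.
move=> A0; rewrite sqrtr_gt0 lt_def so_dot_ge0 andbT.
apply: contraNneq A0 => dA; apply/eqP.
apply: (@weighted_so_dot_eq0 (const_mx 1)) => [i j|]; first by rewrite mxE.
by rewrite -dA; congr so_dot; apply/matrixP => i j; rewrite !mxE mul1r.
Qed.

Lemma wedge_sub a b : (wedge a b <= a^T + b^T)%MS.
Proof.
by rewrite addsmxC addmx_sub_adds ?submxMl // -mulNmx submxMl.
Qed.

(** A nonzero simple bivector, read as a matrix, encodes its own plane: its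
    square rescales [a] and [b] by a nonzero factor, so both lie in its range.
    This lets [Om] itself serve as the plane of a steady rotation. *)
Lemma wedge_eqmx a b : wedge a b != 0 -> (wedge a b == a^T + b^T)%MS.
Proof.
move=> W0; have dW : dot a b ^+ 2 - dot a a * dot b b != 0.
  rewrite -opprB oppr_eq0 -so_dot_wedge -so_norm_sq expf_neq0 //.
  by rewrite gt_eqF // so_norm_gt0.
have sub c : wedge a b *m (wedge a b *m c) =
    (dot a b ^+ 2 - dot a a * dot b b) *: c -> (c^T <= wedge a b)%MS.
  move/(congr1 trmx); rewrite linearZ /= !trmx_mul (tr_wedge a b) mulmxN.
  by rewrite -mulNmx => Ec; rewrite -(eqmx_scale _ dW) -Ec submxMl.
by rewrite wedge_sub addsmx_sub !sub ?wedge_sq_l ?wedge_sq_r.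
Qed.

(** If [b] were a multiple of [a], the wedge would vanish; so [a^T] spans a
    proper subspace of the plane, whose dimension is therefore above 1. *)
Lemma mxrank_wedge a b : wedge a b != 0 -> \rank (wedge a b) = 2%N.
Proof.
move=> W0; rewrite (eqmxP (wedge_eqmx W0)); apply/eqP; rewrite eqn_leq.
have -> /= : (\rank (a^T + b^T) <= 1 + 1)%N.
  by rewrite (leq_trans (mxrank_adds_leqif _ _)) // leq_add ?rank_leq_row.
have ra : \rank a^T = 1%N.
  rewrite rank_rV trmx_eq0; case: (a =P 0) W0 => // ->.
  by rewrite /wedge mul0mx trmx0 mulmx0 subrr eqxx.
rewrite -[X in (X < _)%N]ra; apply: rank_ltmx.
rewrite /ltmx addsmxSl addsmx_sub submx_refl /=.
apply: contra W0 => /sub_rVP[k]; rewrite -linearZ => /trmx_inj ->.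
by rewrite wedgeZr /wedge subrr scaler0.
Qed.

End Wedge.

(** * Differentiation of matrix curves *)

Section MatrixCurves.
Context {R : realType}.

Lemma is_derive_mxP m n (M : R -> 'M[R]_(m, n)) (dM : 'M[R]_(m, n)) (t : R) :
  is_derive t 1 M dM <-> forall i j, is_derive t 1 (fun s => M s i j) (dM i j).
Proof.
split=> [[Mt MtE] i j|Mt].
  have /(_ i j) Mij := (derivable_mxP M t 1).1 Mt.
  by apply: DeriveDef => //; rewrite -MtE derive_mx // mxE.
have dMt : derivable M t 1 by apply/derivable_mxP => i j; apply: ex_derive.
apply: DeriveDef => //; rewrite derive_mx //; apply/matrixP => i j.
by rewrite mxE; apply: derive_val.
Qed.

Lemma is_derive_mulmx m n p (A : R -> 'M[R]_(m, n)) (B : R -> 'M[R]_(n, p))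
    dA dB (t : R) :
  is_derive t 1 A dA -> is_derive t 1 B dB ->
  is_derive t 1 (fun s => A s *m B s) (dA *m B t + A t *m dB).
Proof.
move=> /is_derive_mxP dAt /is_derive_mxP dBt; apply/is_derive_mxP => i j.
rewrite (_ : (fun s => _) = \sum_k ((fun s => A s i k) * (fun s => B s k j))).
  have dAB k := is_deriveM (dAt i k) (dBt k j).
  apply: is_derive_eq.
  rewrite !mxE -big_split /=; apply: eq_bigr => k _.
  by rewrite /GRing.scale /= addrC (mulrC (B _ _ _)).
by apply/funext => s; rewrite fct_sumE mxE.
Qed.

Lemma is_derive_mulmx_cst m n p q (C : 'M[R]_(m, n)) (A : R -> 'M[R]_(n, p))
    (D : 'M[R]_(p, q)) dA (t : R) :
  is_derive t 1 A dA -> is_derive t 1 (fun s => C *m A s *m D) (C *m dA *m D).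
Proof.
move=> dAt.
have dCA := is_derive_mulmx (is_derive_cst C t 1) dAt.
apply: (is_derive_eq (is_derive_mulmx dCA (is_derive_cst D t 1))).
by rewrite mul0mx add0r mulmx0 addr0.
Qed.

Lemma is_derive_trmx m n (A : R -> 'M[R]_(m, n)) dA (t : R) :
  is_derive t 1 A dA -> is_derive t 1 (fun s => (A s)^T) dA^T.
Proof.
move=> /is_derive_mxP dAt; apply/is_derive_mxP => i j.
by under eq_fun do rewrite mxE; rewrite mxE.
Qed.

Lemma is_derive_0_mx_cst m n (A : R -> 'M[R]_(m, n)) :
  (forall t : R, is_derive t 1 A 0) -> forall s t, A s = A t.
Proof.
move=> dA s t; apply/matrixP => i j.
apply: (@is_derive_0_is_cst _ (fun u => A u i j)) => u.
by have /is_derive_mxP /(_ i j) := dA u; rewrite mxE.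
Qed.

End MatrixCurves.

(** * The one-parameter group of a plane rotation *)

Section PlaneRotation.
Context {R : realType} {n : nat}.
Variables (Om : 'M[R]_n) (w : R).

(** The Rodrigues formula for [exp (t Om)], valid when [Om^3 = - w^2 Om]. *)
Definition rotation (t : R) : 'M[R]_n :=
  1%:M + (sin (w * t) / w) *: Om + ((1 - cos (w * t)) / w ^+ 2) *: (Om *m Om).

Hypothesis w_neq0 : w != 0.
Hypothesis Om_skew : Om^T = - Om.
Hypothesis Om_cube : Om *m Om *m Om = - w ^+ 2 *: Om.

Lemma rotation0 : rotation 0 = 1%:M.
Proof. by rewrite /rotation mulr0 sin0 cos0 subrr !mul0r !scale0r !addr0. Qed.

Lemma rotation_comm t : rotation t *m Om = Om *m rotation t.
Proof.
by rewrite !(mulmxDl, mulmxDr) mul1mx mulmx1 -!scalemxAl -!scalemxAr !mulmxA.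
Qed.

(** Common to two uses: the right-hand side is the derivative of the rotation,
    and the parities of its two terms under transposition separate them. *)
Lemma rotationM_Om t :
  Om *m rotation t = cos (w * t) *: Om + (sin (w * t) / w) *: (Om *m Om).
Proof.
rewrite !mulmxDr mulmx1 -!scalemxAr mulmxA Om_cube scalerA addrAC.
rewrite -[X in X + _ + _]scale1r -scalerDl; congr (_ *: _ + _).
by field.
Qed.

Lemma is_derive_rotation (t : R) :
  is_derive t 1 rotation (Om *m rotation t).
Proof.
apply/is_derive_mxP => i j.
have dw : is_derive t (1 : R) (w \*: (@id R)) w.
  by apply: is_derive_eq; rewrite /GRing.scale /= mulr1.
have dsin : is_derive t 1 (sin \o (w \*: @id R)) (cos (w * t) * w).
  exact: is_derive1_comp.
have dcos : is_derive t 1 (cos \o (w \*: @id R)) (- sin (w * t) * w).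
  exact: is_derive1_comp.
rewrite rotationM_Om (_ : (fun s => _) =
  cst ((1%:M : 'M[R]_n) i j + (Om *m Om) i j / w ^+ 2) +
  ((Om i j / w) \*: (sin \o (w \*: @id R)) -
   ((Om *m Om) i j / w ^+ 2) \*: (cos \o (w \*: @id R)))).
  apply: is_derive_eq; rewrite !mxE /GRing.scale /=; field.
  exact: w_neq0.
apply/funext => s; rewrite !fctE /= !mxE /GRing.scale /=; field.
exact: w_neq0.
Qed.

(** With [Y] the symmetric part of the rotation and [s Om] its skew part, all
    three matrices commute, so that the product is [Y^2 - s^2 Om^2]; the
    coefficient of [Om^2] vanishes by [cos^2 + sin^2 = 1]. *)
Lemma rotation_tr (t : R) : (rotation t)^T *m rotation t = 1%:M.
Proof.
pose s := sin (w * t) / w; pose c := (1 - cos (w * t)) / w ^+ 2.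
pose Y := 1%:M + c *: (Om *m Om).
have rotE : rotation t = Y + s *: Om by rewrite /rotation addrAC.
have rotTE : (rotation t)^T = Y - s *: Om.
  rewrite rotE !linearD /= !linearZ /= trmx1 trmx_mul Om_skew.
  by rewrite mulNmx mulmxN opprK scalerN.
have Y_comm : Y *m Om = Om *m Y.
  by rewrite mulmxDl mulmxDr mul1mx mulmx1 -scalemxAl -scalemxAr mulmxA.
have Y_sq : Y *m Y = 1%:M + (2 * c - w ^+ 2 * c ^+ 2) *: (Om *m Om).
  rewrite mulmxDl mul1mx mulmxDr mulmx1 -scalemxAl -scalemxAr mulmxA Om_cube.
  rewrite -scalemxAl !scalerA -!addrA -!scalerDl; congr (_ + _ *: _).
  by ring.
have YsOm : Y *m (s *: Om) = (s *: Om) *m Y.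
  by rewrite -scalemxAr Y_comm scalemxAl.
clearbody Y; rewrite rotTE rotE mulmxDl !mulmxDr !mulNmx YsOm addrA addrK Y_sq.
rewrite -scalemxAl -scalemxAr scalerA -addrA -scalerBl -[RHS]addr0.
congr (_ + _).
rewrite (_ : _ - _ = 0) ?scale0r // /c /s.
have := cos2Dsin2 (w * t); set C := cos _; set S := sin _ => CS.
have -> : S / w * (S / w) = (1 - C ^+ 2) / w ^+ 2.
  by rewrite -CS; field.
by field.
Qed.

(** Uniqueness for the linear equation [g' = g Om]: the curve
    [g(t) rotation(t)^T] has zero derivative. *)
Lemma rotation_unique (g : R -> 'M[R]_n) :
  (forall t : R, is_derive t 1 g (g t *m Om)) ->
  forall t, g t = g 0 *m rotation t.
Proof.
move=> dg t.
have cst : g t *m (rotation t)^T = g 0 *m (rotation 0)^T.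
  apply: (@is_derive_0_mx_cst _ _ _ (fun s => g s *m (rotation s)^T)) => s.
  apply: (is_derive_eq
    (is_derive_mulmx (dg s) (is_derive_trmx (is_derive_rotation s)))).
  by rewrite -rotation_comm trmx_mul Om_skew mulNmx mulmxN mulmxA subrr.
have := congr1 (mulmx^~ (rotation t)) cst.
by rewrite -!mulmxA rotation_tr rotation0 trmx1 !(mulmx1, mul1mx).
Qed.

End PlaneRotation.

(** * Least period of a plane rotation *)

Section Period.
Context {R : realType} {n : nat}.
Variables (Om : 'M[R]_n) (w : R).

Lemma cos_neq1_lt2pi (x : R) : 0 < x < 2 * pi -> cos x != 1.
Proof.
move=> /andP[x_gt0 x_lt]; rewrite (_ : x = (x / 2) *+ 2); last first.
  by rewrite -mulr_natr divfK.
have s_gt0 : 0 < sin (x / 2).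
  by rewrite sin_gt0_pi // divr_gt0 //= ltr_pdivrMr // mulrC.
have := cos2Dsin2 (x / 2); rewrite cos_mulr2n => cs.
have := mulr_gt0 s_gt0 s_gt0.
by rewrite -expr2 => s2_gt0; rewrite lt_eqF //; lra.
Qed.

Lemma rotation_periodic (w_neq0 : w != 0) :
  periodic (rotation Om w) (2 * pi / w).
Proof.
move=> t; rewrite /rotation (_ : w * _ = w * t + pi *+ 2); last first.
  by rewrite -mulr_natr; field.
by rewrite sinD2pi cosD2pi.
Qed.

(** If the rotation of time [s] were trivial, [rotationM_Om] would read
    [Om = cos (w s) Om + (sin (w s) / w) Om^2].  Subtracting the transpose
    removes the symmetric term and leaves [cos (w s) = 1]. *)
Lemma rotation_neq1 (w_gt0 : 0 < w) (s : R) :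
  Om^T = - Om -> Om *m Om *m Om = - w ^+ 2 *: Om -> Om != 0 ->
  0 < s < 2 * pi / w -> rotation Om w s <> 1%:M.
Proof.
move=> Om_skew Om_cube Om_neq0 /andP[s_gt0 s_lt] rot1.
have w_neq0 : w != 0 by rewrite gt_eqF.
have := rotationM_Om w_neq0 Om_cube s; rewrite rot1 mulmx1 => E1.
have := congr1 trmx E1; rewrite linearD /= !linearZ /= trmx_mul Om_skew.
rewrite mulNmx mulmxN opprK scalerN => E2.
have : (2 * (1 - cos (w * s))) *: Om = 0.
  have := congr2 (fun A B => A - B) E1 E2.
  rewrite /= opprK opprD opprK addrACA subrr addr0 => E3.
  rewrite mulrBr mulr1 scalerBl -scalerA -[X in X - _ = _]/(2 *: _).
  by rewrite !scaler_nat !mulr2n {1}E3 subrr.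
move/eqP; rewrite scaler_eq0 (negPf Om_neq0) orbF mulf_eq0 pnatr_eq0 /=.
rewrite subr_eq0 eq_sym.
apply/negP/cos_neq1_lt2pi; rewrite mulr_gt0 //=.
by rewrite mulrC -ltr_pdivlMr.
Qed.

End Period.

(** * Inertia tensor *)

Section Inertia.
Context {R : realType} {n : nat}.
Variable J : 'rV[R]_n.
Implicit Types (a b : 'cV[R]_n) (A B : 'M[R]_n).

(** The cross terms [A M A] cancel, so that the gyroscopic term is the
    commutator of the mass tensor with [A^2]. *)
Lemma lie_inertia A :
  lie (inertia J A) A = mass_tensor J *m (A *m A) - (A *m A) *m mass_tensor J.
Proof. by rewrite /lie /inertia mulmxDl mulmxDr !mulmxA opprD addrA addrK. Qed.

Lemma inertia_wedge a b :
  inertia J (wedge a b) =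
  wedge (mass_tensor J *m a) b + wedge a (mass_tensor J *m b).
Proof.
rewrite /inertia /wedge !trmx_mul tr_diag_mx mulmxBr mulmxBl !mulmxA.
by rewrite addrACA -opprD [X in _ - X]addrC opprD addrACA.
Qed.

Lemma so_dot_inertia_inv A B :
  so_dot (inertia_inv J A) B = so_dot (inertia_inv J B) A.
Proof.
rewrite !so_dotE; congr (_ * _); apply: eq_bigr => i _; apply: eq_bigr => j _.
by rewrite !mxE mulrAC (mulrC (A i j)) mulrAC.
Qed.

Lemma inertia_inv_dot_eq0 A : (forall i, 0 < J 0 i) ->
  so_dot (inertia_inv J A) A = 0 -> A = 0.
Proof.
move=> J_gt0 A0.
apply: (@weighted_so_dot_eq0 _ _ (\matrix_(i, j) (J 0 i + J 0 j)^-1)).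
  by move=> i j; rewrite mxE invr_gt0 addr_gt0.
by rewrite -[RHS]A0; congr so_dot; apply/matrixP => i j; rewrite !mxE mulrC.
Qed.

End Inertia.

(** * Moving frame and reaction *)

Section Frame.
Context {R : realType} {n : nat}.
Implicit Types (g : 'M[R]_n).

Lemma invmx_orthogonal g : orthogonal_mx g -> invmx g = g^T.
Proof.
move=> gg; have [_ gu] := mulmx1_unit gg.
by rewrite -[LHS]mul1mx -gg mulmxK.
Qed.

Lemma dot_mul (A : 'M[R]_n) (a b : 'cV[R]_n) :
  A^T *m A = 1%:M -> dot (A *m a) (A *m b) = dot a b.
Proof. by move=> AA; rewrite /dot trmx_mul -mulmxA (mulmxA A^T) AA mul1mx. Qed.

Lemma dot_invmx g (a b : 'cV[R]_n) : orthogonal_mx g ->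
  dot (invmx g *m a) (invmx g *m b) = dot a b.
Proof.
move=> gg; apply: dot_mul; rewrite (invmx_orthogonal gg) trmxK.
by apply: mulmx1C.
Qed.

Lemma dot_delta (i j : 'I_n) :
  dot (delta_mx i 0) (delta_mx j 0) = (i == j)%:R :> R.
Proof.
by rewrite /dot trmx_delta mul_delta_mx_cond mulmxnE mxE !eqxx.
Qed.

Lemma space_axis1E (i0 : 'I_n) : val i0 = 0%N ->
  space_axis1 = delta_mx i0 0 :> 'cV[R]_n.
Proof.
by move=> i0E; apply/matrixP => i j; rewrite !mxE (ord1 j) andbT -i0E.
Qed.

Lemma dot_space_axis1 (n_gt0 : (0 < n)%N) :
  dot space_axis1 (space_axis1 : 'cV[R]_n) = 1.
Proof. by rewrite (@space_axis1E (Ordinal n_gt0)) // dot_delta eqxx. Qed.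

Lemma dot_space_axis (r : 'I_n) : (0 < r)%N ->
  dot (space_axis r) space_axis1 = 0 :> R.
Proof.
move=> r_gt0; have n_gt0 : (0 < n)%N by apply: leq_trans (ltn_ord r).
rewrite (@space_axis1E (Ordinal n_gt0)) // /space_axis dot_delta -val_eqE /=.
by rewrite gtn_eqF.
Qed.

(** The reaction is a combination of bivectors [E_r /\ E_s] with [r, s]
    different from the distinguished index, and these axes are orthogonal to
    [q]. *)
Lemma reaction_axis1 g lam : orthogonal_mx g ->
  reaction g lam *m body_axis1 g = 0.
Proof.
move=> gg; rewrite /reaction mulmx_suml big1 // => r _.
rewrite mulmx_suml big1 // => s /andP[r_gt0 rs]; rewrite -scalemxAl wedge_mul.
rewrite /body_axis /body_axis1 !dot_invmx // !dot_space_axis //.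
  by rewrite !scale0r subrr scaler0.
exact: leq_trans rs.
Qed.

End Frame.

(** * Gyroscopic term and steady motion *)

Section Steady.
Context {R : realType} {n : nat}.
Variable J : 'rV[R]_n.
Implicit Types (g Om : R -> 'M[R]_n).

Lemma is_derive_unique (V : normedModType R) (f : R -> V) (t : R) (a b : V) :
  is_derive t 1 f a -> is_derive t 1 f b -> a = b.
Proof. by move=> [_ <-] [_ <-]. Qed.

(** When the gyroscopic term vanishes, the equations for the multipliers say
    that the reaction is orthogonal, for the form given by the inverse inertia
    tensor, to every [E_p /\ E_q], hence to itself. *)
Lemma reaction_eq0 (g0 Om0 lam : 'M[R]_n) : (forall i, 0 < J 0 i) ->
  multipliers J g0 Om0 lam -> lie (inertia J Om0) Om0 = 0 ->
  reaction g0 lam = 0.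
Proof.
move=> J_gt0 lamP lie0; apply: (inertia_inv_dot_eq0 J_gt0).
rewrite [X in so_dot _ X]/reaction so_dot_sumr big1 // => p _.
rewrite so_dot_sumr big1 // => q pq; rewrite so_dotZr so_dot_inertia_inv.
have := lamP p q pq; rewrite /= lie0 so_dot0r oppr0 => sum0.
rewrite /reaction so_dot_sumr; under eq_bigr do rewrite so_dot_sumr.
under eq_bigr do under eq_bigr do rewrite so_dotZr mulrC.
by rewrite sum0 mulr0.
Qed.

(** With [X = A^2] and [C = M X - X M], multiplying [C A = 0] by [A] gives
    [- w M X = X M X] since [X^2 = - w X].  The right-hand side is symmetric, so
    [M X] is symmetric, which means [C = 0]. *)
Lemma lie0_of_annihilated (A : 'M[R]_n) (w : R) : w != 0 -> A^T = - A ->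
  A *m A *m A = - w *: A -> lie (inertia J A) A *m A = 0 ->
  lie (inertia J A) A = 0.
Proof.
move=> w_neq0 A_skew A_cube; rewrite lie_inertia.
set M := mass_tensor J; set X := A *m A => CA.
have X_sym : X^T = X by rewrite /X trmx_mul A_skew mulNmx mulmxN opprK.
have M_sym : M^T = M by apply: tr_diag_mx.
have XX : X *m X = - w *: X by rewrite {2}/X mulmxA A_cube -scalemxAl.
have MX : - w *: (M *m X) = X *m M *m X.
  have := congr1 (mulmx^~ A) CA; rewrite /= mul0mx -mulmxA -/X mulmxBl => /eqP.
  by rewrite subr_eq0 -(mulmxA M X X) XX -scalemxAr => /eqP.
clearbody X.
have XM : - w *: (X *m M) = X *m M *m X.
  have := congr1 trmx MX; rewrite linearZ /= !trmx_mul X_sym M_sym => ->.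
  by rewrite mulmxA.
apply/eqP; rewrite subr_eq0; apply/eqP.
by apply: (@scalerI _ _ (- w)); rewrite ?oppr_eq0 // MX XM.
Qed.

(** The constant matrix [C] annihilates the moving axis [q], hence also its
    velocity [- Om q]; these two vectors span the plane of [Om], so that
    [C Om = 0]. *)
Lemma steady_lie g Om : (0 < n)%N -> steady_rotation J g Om ->
  forall t, lie (inertia J (Om t)) (Om t) = 0.
Proof.
move=> n_gt0 [sol [Om0 Om0_neq0 OmE]] t; rewrite OmE.
set C := lie _ _.
(* The momentum is constant, so the equation reads [C + reaction = 0]. *)
have Cq s : C *m body_axis1 (g s) = 0.
  have [[gg _ _] _ [lam _ dI]] := sol s.
  have dI0 : is_derive s 1 (fun u => inertia J (Om u)) 0.
    rewrite (_ : (fun u => _) = cst (inertia J Om0)).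
      exact: is_derive_cst.
    by apply/funext => u; rewrite OmE.
  have := is_derive_unique dI dI0; rewrite OmE -/C.
  move=> /(congr1 (mulmx^~ (body_axis1 (g s)))).
  by rewrite mulmxDl reaction_axis1 // addr0 mul0mx.
have [[gg _ [v OmtE]] dg _] := sol t.
have Om0E : Om0 = wedge (body_axis1 (g t)) v by rewrite -OmtE OmE.
set q := body_axis1 (g t) in Om0E.
have Om0_skew : Om0^T = - Om0 by rewrite Om0E tr_wedge.
(* Differentiating [Cq]: the axis is [g^T e_1], with velocity [- Om q]. *)
have COmq : C *m (Om0 *m q) = 0.
  have d1 := is_derive_mulmx_cst C (space_axis1 : 'cV[R]_n) (is_derive_trmx dg).
  have d0 : is_derive t 1 (fun s => C *m (g s)^T *m (space_axis1 : 'cV[R]_n)) 0.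
    rewrite (_ : (fun s => _) = cst 0); first exact: is_derive_cst.
    apply/funext => s; have [[ggs _ _] _ _] := sol s.
    by rewrite -mulmxA -invmx_orthogonal //= Cq.
  have := is_derive_unique d1 d0; rewrite OmE trmx_mul Om0_skew mulNmx mulmxN.
  rewrite mulNmx => /eqP; rewrite oppr_eq0 => /eqP.
  by rewrite -(invmx_orthogonal gg) /q /body_axis1 !mulmxA.
have Cqt : C *m q = 0 := Cq t.
have qq : dot q q = 1 by rewrite dot_invmx // dot_space_axis1.
(* As [q] is a unit vector, [v] is a combination of [q] and [Om q]. *)
have Cv : C *m v = 0.
  have := COmq; rewrite {1}Om0E wedge_mul qq scale1r mulmxBr -scalemxAr Cqt.
  by rewrite scaler0 sub0r => /eqP; rewrite oppr_eq0 => /eqP.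
apply: (@lie0_of_annihilated _ (so_dot Om0 Om0)) => //.
- by rewrite -so_norm_sq expf_neq0 // gt_eqF // so_norm_gt0.
- by rewrite Om0E wedge_cube.
- rewrite -/C [X in C *m X]Om0E mulmxBr (mulmxA C q) (mulmxA C v) Cqt Cv.
  by rewrite !mul0mx subrr.
Qed.

Lemma lie0_steady g Om : (forall i, 0 < J 0 i) ->
  veselova_solution J g Om -> (exists t, Om t != 0) ->
  (forall t, lie (inertia J (Om t)) (Om t) = 0) -> steady_rotation J g Om.
Proof.
move=> J_gt0 sol [t0 Omt0] lie0; split=> //; exists (Om t0) => // t.
apply: (can_inj (inertiaK J_gt0)).
apply: (@is_derive_0_mx_cst _ _ _ (fun s => inertia J (Om s))) => s.
have [_ _ [lam lamP dI]] := sol s.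
by move: dI; rewrite lie0 add0r (reaction_eq0 J_gt0 lamP (lie0 s)).
Qed.

(** Stability of the plane: up to a nonzero factor [W] is [W^3], and [M]
    commutes with [W^2], so [W M] is proportional to [W^3 M = (W M W) W], whose
    rows lie in the row space of [W]. *)
Lemma lie0_principal (a b : 'cV[R]_n) (W := wedge a b) : W != 0 ->
  lie (inertia J W) W = 0 -> rotation_in_principal_plane J W W.
Proof.
move=> W_neq0; rewrite lie_inertia => /eqP; rewrite subr_eq0 => /eqP MW.
split; last by exists a, b, 1; rewrite oner_neq0 scale1r wedge_eqmx.
split; first exact: mxrank_wedge.
have w_neq0 : - so_dot W W != 0.
  by rewrite oppr_eq0 -so_norm_sq expf_neq0 // gt_eqF // so_norm_gt0.
rewrite -(eqmx_scale _ w_neq0) scalemxAl -wedge_cube -/W.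
by rewrite -!mulmxA (mulmxA W W (mass_tensor J)) -MW !mulmxA submxMl.
Qed.

Lemma steady_principal g Om : (0 < n)%N -> steady_rotation J g Om ->
  exists P : 'M[R]_n, forall t, rotation_in_principal_plane J P (Om t).
Proof.
move=> n_gt0 steady; have [sol [Om0 Om0_neq0 OmE]] := steady.
exists Om0 => t; rewrite OmE.
have [[_ _ [v Om0E]] _ _] := sol 0; rewrite OmE in Om0E.
have lie0 := steady_lie n_gt0 steady 0; rewrite OmE in lie0.
by rewrite Om0E in Om0_neq0 lie0 *; apply: lie0_principal.
Qed.

(** The witness is the uniform rotation, starting from the identity, in the
    plane of the distinguished axis and the next coordinate axis. *)
Lemma steady_exists : (2 <= n)%N -> (forall i, 0 < J 0 i) ->
  exists g Om, steady_rotation J g Om.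
Proof.
move=> n_ge2 J_gt0.
pose i0 : 'I_n := Ordinal (ltnW n_ge2); pose i1 : 'I_n := Ordinal n_ge2.
pose a : 'cV[R]_n := delta_mx i0 0; pose b : 'cV[R]_n := delta_mx i1 0.
pose Om0 := wedge a b.
have dOm0 : so_dot Om0 Om0 = 1.
  by rewrite so_dot_wedge !dot_delta !eqxx -val_eqE /= expr0n subr0 mulr1.
have Om0_neq0 : Om0 != 0.
  by apply: contra_eq_neq dOm0 => ->; rewrite so_dot0r eq_sym oner_neq0.
have Om0_cube : Om0 *m Om0 *m Om0 = - 1 ^+ 2 *: Om0.
  by rewrite wedge_cube dOm0 expr1n.
have Om0_skew : Om0^T = - Om0 by apply: tr_wedge.
have inOm0 : inertia J Om0 = (J 0 i0 + J 0 i1) *: Om0.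
  have Me i :
      mass_tensor J *m (delta_mx i 0 : 'cV[R]_n) = J 0 i *: delta_mx i 0.
    apply/matrixP => k l; rewrite mul_diag_mx !mxE.
    by case: eqP => [->|] //=; rewrite !mulr0.
  by rewrite inertia_wedge !Me wedgeZl wedgeZr -scalerDl.
have lie0 : lie (inertia J Om0) Om0 = 0.
  by rewrite inOm0 /lie -scalemxAl -scalemxAr subrr.
exists (rotation Om0 1), (cst Om0); split; last by exists Om0.
move=> t; have rotT := rotation_tr (oner_neq0 R) Om0_skew Om0_cube t.
have drot := is_derive_rotation (oner_neq0 R) Om0_cube t.
split.
- split=> //; exists ((rotation Om0 1 t)^T *m b).
  rewrite /body_axis1 invmx_orthogonal // (@space_axis1E _ _ i0) //.
  (* The wedge of two rotated vectors is the conjugate of their wedge, and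
     [Om0] commutes with its own rotations. *)
  rewrite /wedge !trmx_mul trmxK !mulmxA -!(mulmxA _^T).
  by rewrite -mulmxBr -mulmxBl -[_ - _]/Om0 -rotation_comm mulmxA rotT mul1mx.
- by rewrite rotation_comm.
- exists 0 => [p q _ /=|].
    rewrite lie0 so_dot0r oppr0 big1 // => r _; rewrite big1 // => s _.
    by rewrite mxE mulr0.
  rewrite lie0 add0r /reaction big1 => [|r _].
    exact: (is_derive_cst (inertia J Om0)).
  by rewrite big1 // => s _; rewrite mxE scale0r.
Qed.

(** The matrix [g(0)] is invertible, so [g = g(0) rotation] has exactly the
    periods of the rotation. *)
Lemma steady_period g Om : steady_rotation J g Om ->
  forall t,
  least_period (fun s => (g s, Om s)) (2 * pi / so_norm (Om t)).
Proof.
move=> [sol [Om0 Om0_neq0 OmE]] t; rewrite OmE.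
set w := so_norm Om0.
have w_gt0 : 0 < w by apply: so_norm_gt0.
have w_neq0 : w != 0 by rewrite gt_eqF.
have [[gg Om0_skew [v Om0E]] _ _] := sol 0; rewrite OmE in Om0_skew Om0E.
have Om0_cube : Om0 *m Om0 *m Om0 = - w ^+ 2 *: Om0.
  by rewrite so_norm_sq Om0E wedge_cube.
have gE : forall s, g s = g 0 *m rotation Om0 w s.
  apply: rotation_unique => // s.
  by have [_ dg _] := sol s; rewrite OmE in dg.
split.
- by rewrite divr_gt0 // mulr_gt0 ?pi_gt0.
- by move=> s; rewrite !OmE (gE (_ + _)) rotation_periodic // -gE.
move=> s s_bd per; have := per 0; rewrite add0r => -[gs _].
have [_ gu] := mulmx1_unit gg.
apply: (@rotation_neq1 _ _ Om0 w w_gt0 s) => //.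
by rewrite -[LHS](mulKmx gu) -gE gs mulVmx.
Qed.

End Steady.

(** * Moment of inertia of a principal plane *)

Section TwoByTwo.
Context {F : numFieldType}.

(** A monic quadratic with one root splits, and the trace gives the other
    root. *)
Lemma char_poly_root2 m (A : 'M[F]_m) (l : F) : m = 2%N ->
  root (char_poly A) l ->
  char_poly A = ('X - l%:P) * ('X - (\tr A - l)%:P).
Proof.
move=> m2; subst m; rewrite root_factor_theorem dvdp_eq.
set q := _ %/ _ => /eqP pE.
have q_monic : q \is monic.
  by rewrite -(monicMr _ (monicXsubC l)) -pE char_poly_monic.
have size_q : size q = 2%N.
  have := size_char_poly A; rewrite pE size_Mmonic ?monicXsubC //.
    by rewrite size_XsubC addn2 => -[].
  by rewrite monic_neq0.
have qE : q = 'X + (q`_0)%:P.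
  apply/polyP => i; rewrite coefD coefX coefC; case: i => [|[|i]] /=.
  - by rewrite add0r.
  - by move/monicP: q_monic; rewrite lead_coefE size_q addr0.
  - by rewrite addr0 nth_default // size_q.
have trE := char_poly_trace A isT; rewrite /= pE qE in trE.
rewrite mulrBr coefB coefMX coefMC /= !coefD !coefX !coefC /= in trE.
rewrite add0r addr0 mul1r in trE.
rewrite pE qE mulrC; congr (_ * _).
by rewrite -polyCN; congr (_ + _%:P); rewrite opprB -[LHS](subrK l) trE addrC.
Qed.

(** The bivectors of a plane form a line, on which the derivation induced by
    [A] is multiplication by its trace. *)
Lemma skew2_derivation m (A S : 'M[F]_m) : m = 2%N -> S^T = - S ->
  A^T *m S + S *m A = \tr A *: S.
Proof.
move=> m2; subst m => S_skew.
have SN i j : S j i = - S i j by have /matrixP /(_ i j) := S_skew; rewrite !mxE.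
have Sii i : S i i = 0 by apply/eqP; rewrite -eqNr -SN.
apply/matrixP => i j; rewrite /mxtrace !mxE !big_ord_recl !big_ord0 !mxE.
have ord2 (k : 'I_2) : k = ord0 \/ k = lift ord0 ord0.
  by case: k => [[|[|//]] ?]; [left | right]; apply/val_inj.
have S10 := SN ord0 (lift ord0 ord0).
by case: (ord2 i) => ->; case: (ord2 j) => ->; rewrite !Sii ?S10; ring.
Qed.

(** The minimal polynomial of the restriction divides that of the diagonal
    matrix, which is a product of linear factors, and it is not constant; so it
    has one of the diagonal entries as a root. *)
Lemma eigenvalue_conj_diag m n (B : 'M[F]_(m, n)) (d : 'rV[F]_n) :
  (0 < m)%N -> row_free B -> stablemx B (diag_mx d) ->
  exists l, root (char_poly (conjmx B (diag_mx d))) l.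
Proof.
case: m B => // m; case: n d => [|n] d B _ Bfree Bstable.
  by have := Bfree; rewrite /row_free thinmx0 mxrank0.
have := mxminpoly_conj Bfree Bstable; rewrite mxminpoly_diag.
move=> /dvdp_prod_XsubC[msk]; set s := mask _ _ => pE.
case: s pE => [|l s] pE.
  have := size_mxminpoly (conjmx B (diag_mx d)).
  rewrite (eqp_size pE) big_nil size_poly1 => -[] deg0.
  by have := mxminpoly_nonconstant (conjmx B (diag_mx d)); rewrite -deg0.
exists l; rewrite -root_mxminpoly (eqp_root pE) big_cons rootM.
by rewrite root_XsubC eqxx.
Qed.

End TwoByTwo.

Section Moment.
Context {R : realType} {n : nat}.
Variable J : 'rV[R]_n.
Implicit Types (A P : 'M[R]_n).

(** The moment of inertia is defined through a splitting of the characteristic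
    polynomial, whose existence over the reals is the content here. *)
Lemma moment_of_inertia_trace P : principal_plane J P ->
  moment_of_inertia J P = \tr (restrictmx P (mass_tensor J)).
Proof.
move=> [rP Pst].
have [l lroot] : exists l, root (char_poly (restrictmx P (mass_tensor J))) l.
  apply: eigenvalue_conj_diag; rewrite ?rP ?row_base_free //.
  by rewrite stablemx_row_base.
have lm : plane_eigenvalues J P l (\tr (restrictmx P (mass_tensor J)) - l).
  exact: char_poly_root2.
by rewrite (moment_of_inertiaE lm) addrC subrK.
Qed.

(** In coordinates on the plane, [A = B^T S B] where the rows of [B] form a
    basis and [S] is a skew matrix of size 2, and [B M = D B] where [D] is the
    restriction of [M]; so the inertia tensor turns [S] into
    [D^T S + S D]. *)
Lemma inertia_principal P A : rotation_in_principal_plane J P A ->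
  inertia J A = moment_of_inertia J P *: A.
Proof.
move=> [Pp [a [b [c [c_neq0 Pab AE]]]]]; rewrite (moment_of_inertia_trace Pp).
have [rP Pst] := Pp.
have A_skew : A^T = - A by rewrite AE linearZ /= tr_wedge scalerN.
have AP : (A <= P)%MS by rewrite AE scalemx_sub // (eqmxP Pab) wedge_sub.
set M := mass_tensor J; set B := row_base P; set D := restrictmx P M.
have AB : A *m pinvmx B *m B = A by rewrite mulmxKpV // eq_row_base.
have DB : D *m B = B *m M by rewrite /D /conjmx mulmxKpV // stablemx_row_base.
move: (pinvmx B) AB => K AB; clearbody D B.
have BA : B^T *m K^T *m A = A.
  have := congr1 trmx AB; rewrite !trmx_mul A_skew !mulmxN mulmxA.
  exact: oppr_inj.
pose S := K^T *m A *m K.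
have AS : A = B^T *m S *m B.
  by rewrite /S !mulmxA BA AB.
have S_skew : S^T = - S.
  by rewrite /S !trmx_mul trmxK A_skew mulNmx mulmxN mulmxA.
have BD : M *m B^T = B^T *m D^T.
  by rewrite -trmx_mul DB trmx_mul tr_diag_mx.
clearbody S; rewrite /inertia -/M AS !mulmxA BD -!(mulmxA _ B M) -DB !mulmxA.
have -> : B^T *m D^T *m S *m B + B^T *m S *m D *m B =
    B^T *m (D^T *m S + S *m D) *m B by rewrite mulmxDr mulmxDl !mulmxA.
by rewrite skew2_derivation // -scalemxAr -scalemxAl.
Qed.

End Moment.

(** * Steady rotations of the Veselova system *)

Theorem proposition2p1 (R : realType) (n : nat) (n_ge2 : (2 <= n)%N)
    (J : 'rV[R]_n) (J_gt0 : forall i, 0 < J 0 i) :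
  [/\ exists g Om : R -> 'M[R]_n, steady_rotation J g Om,
      forall g Om : R -> 'M[R]_n, steady_rotation J g Om ->
        exists P : 'M[R]_n, forall t, rotation_in_principal_plane J P (Om t),
      forall g Om : R -> 'M[R]_n, veselova_solution J g Om ->
        (exists t, Om t != 0) ->
        (steady_rotation J g Om <->
         forall t, lie (inertia J (Om t)) (Om t) = 0) &
      forall (g Om : R -> 'M[R]_n) (P : 'M[R]_n),
        steady_rotation J g Om ->
        (forall t, rotation_in_principal_plane J P (Om t)) ->
        forall t,
        [/\ least_period (fun s => (g s, Om s)) (2 * pi / so_norm (Om t)),
            energy J (Om t) =
              2^-1 * moment_of_inertia J P * so_norm (Om t) ^+ 2 &
            so_norm (inertia J (Om t)) ^+ 2 =
              moment_of_inertia J P ^+ 2 * so_norm (Om t) ^+ 2]].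
Proof.
have n_gt0 : (0 < n)%N by apply: ltnW.
split.
- exact: steady_exists.
- by move=> g Om; apply: steady_principal.
- move=> g Om sol Om_neq0; split; first exact: steady_lie.
  exact: lie0_steady.
- move=> g Om P steady OmP t; have inOm := inertia_principal (OmP t).
  split; first exact: steady_period steady t.
  + by rewrite /energy inOm so_dotC so_dotZr -so_norm_sq mulrA.
  + by rewrite !so_norm_sq inOm so_dotZr so_dotC so_dotZr mulrA -expr2.
Qed.
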